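(* Let $n\in\mathbb{N}$, $C=\{1,\dots,n\}$, and let $M=(m_{ij})_{i,j=1,\dots,n}$ be a stochastic matrix. Define $w=(w_j)_{j=1,\dots,n}\in\mathbb{R}^n$ by $$w_j=\sum_{\gamma\in\Gamma_j}\ \prod_{e_{ik}\in E(\gamma)} m_{ik},$$ where $\Gamma_j$ is the set of all directed trees on the vertex set $C$ rooted at $j$. Then $w^T M=w^T$.
   Context: A stochastic matrix is a real square matrix $M$ with non-negative entries and $M\mathbf{1}=\mathbf{1}$, where $\mathbf{1}=(1,\dots,1)^T$ (each row sums to 1). Graphs are directed graphs $\gamma$ with vertex set $C$ and edge set $E(\gamma)\subseteq C\times C$; $e_{ik}$ denotes the directed edge from $i$ to $k$. A directed loop is a closed directed path, i.e. a set of edges $\{e_{i_1i_2},e_{i_2i_3},\dots,e_{i_mi_1}\}$ (a self-edge $e_{ii}$ is a directed loop); a graph is acyclic if it contains no directed loop. For $j\in C$, $\Gamma_j$ is the set of all directed graphs $\gamma$ with vertex set $C$ such that (a) $\gamma$ is acyclic, and (b) each vertex in $C\setminus\{j\}$ has exactly one outgoing edge and $j$ has no outgoing edge. The graphs in $\Gamma_j$ are arbitrary subgraphs of the complete directed graph on $C$ (they do not have to use only edges with $m_{ik}\neq 0$). An empty product equals 1. *)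

(* Defs.v *)
From HB Require Import structures.
From mathcomp Require Import all_boot all_order all_algebra.
From mathcomp Require Import boolp reals.

Set Implicit Arguments.
Unset Strict Implicit.
Unset Printing Implicit Defensive.

Import Order.TTheory GRing.Theory Num.Theory.
Local Open Scope ring_scope.

Definition stochastic (R : realType) (n : nat) (M : 'M[R]_n) : Prop :=
  (forall i k, 0 <= M i k) /\ M *m const_mx 1 = const_mx 1 :> 'cV[R]_n.

(* A directed graph with vertex set C is given by its set of edges, the pair
   (i, k) standing for the edge from i to k; self-edges are allowed. *)
Definition digraph (C : finType) := {set C * C}.

(* The vertices i_1, ..., i_m (m >= 1) of a closed directed path
   i_1 -> i_2 -> ... -> i_m -> i_1; the case m = 1 is a self-edge. *)
Definition directed_loop (C : finType) (g : digraph C) (c : seq C) : bool :=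
  (c != [::]) && cycle [rel i k | (i, k) \in g] c.

Definition acyclic (C : finType) (g : digraph C) : Prop :=
  forall c : seq C, ~~ directed_loop g c.

Definition out_edges (C : finType) (g : digraph C) (i : C) : {set C * C} :=
  [set e in g | e.1 == i].

(* The edges range over the complete directed graph on C, and point towards
   the root j. *)
Definition rooted_trees (C : finType) (j : C) : {set digraph C} :=
  [set g : digraph C |
    [&& `[< acyclic g >],
        [forall (i | i != j), #|out_edges g i| == 1%N] &
        #|out_edges g j| == 0%N]].

Definition tree_weight (R : realType) (n : nat) (M : 'M[R]_n) : 'cV[R]_n :=
  \col_j \sum_(g in rooted_trees j) \prod_(e in g) M e.1 e.2.

(* Main.v *)
Require Import Defs.
From HB Require Import structures.
From mathcomp Require Import all_boot all_order all_algebra.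
From mathcomp Require Import boolp reals.

Set Implicit Arguments.
Unset Strict Implicit.
Unset Printing Implicit Defensive.

Import Order.TTheory GRing.Theory Num.Theory.
Local Open Scope ring_scope.

(** The theorem compares two ways of cutting an edge out of the same family of
    graphs.  Fix a vertex k and consider the maps f : C -> C all of whose
    orbits meet k; equivalently, the functional graphs with a single cycle,
    which passes through k.  Give f the weight \prod_i M i (f i).

    Cutting the edge that leaves k turns such an f into a tree rooted at k, and
    the tree together with the value f k gives back f; so the total weight of
    the family is \sum_i w_k m_ki, which is w_k because the rows of M sum
    to 1.  Cutting instead the edge of the cycle that enters k, say from i,
    turns f into a tree rooted at i, and the tree with its root gives back f;
    so the total weight is also \sum_i w_i m_ik.

    Both cuts are instances of [tree_sum_mulr], which says that w_j m_jk is the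
    weight of the maps whose orbits all meet j and which send j to k.  It rests
    on the dictionary [graph_off_rooted] between trees rooted at j and maps
    whose orbits all meet j.  That the second cut is well defined, i.e. that
    exactly one edge into k lies on the cycle, is
    [reaches_predecessor]. *)

(** * Maps whose orbits all meet a given vertex *)

Definition reaches (C : finType) (f : C -> C) (j : C) : bool :=
  [forall x, fconnect f x j].

Lemma reaches_trans (C : finType) (f : C -> C) (j k : C) :
  reaches f j -> fconnect f j k -> reaches f k.
Proof.
move=> /forallP rj jk; apply/forallP=> x; exact: connect_trans (rj x) jk.
Qed.

(** An orbit eventually repeats itself, so one that misses j runs into a cycle
    that misses j. *)
Lemma reachesPn (C : finType) (f : C -> C) (j : C) :
  ~~ reaches f j -> exists2 c : seq C, c != [::] & fcycle f c && (j \notin c).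
Proof.
move=> /forallPn[x xj].
have /trajectP[i io eqi] := looping_order f x.
set y := iter i f x in eqi.
pose p := (order f x - i)%N.
have p_gt0 : (0 < p)%N by rewrite subn_gt0.
have iter_p : iter p f y = y by rewrite -iterD subnK // ltnW.
exists (traject f y p); first by rewrite -size_eq0 size_traject -lt0n.
apply/andP; split; last first.
  apply/trajectP=> -[m _ jm]; case/negP: xj.
  by rewrite jm -iterD fconnect_iter.
move: p_gt0 iter_p; case: p => // q _ iter_q.
rewrite /= -[X in rcons _ X]iter_q iterSr -trajectSr; exact: fpath_traject.
Qed.

(** Each of i and i' reaches the other, so they lie on one cycle of f and share
    a period p > 0; hence i = f^(p-1) (f i) = f^(p-1) (f i') = i'. *)
Lemma reaches_predecessor_inj (C : finType) (f : C -> C) (i i' : C) :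
  reaches f i -> reaches f i' -> f i = f i' -> i = i'.
Proof.
move=> /forallP ri /forallP ri' fii'.
pose p := (findex f (f i) i).+1.
have per_i : iter p f i = i by rewrite iterSr iter_findex.
have per_i' : iter p f i' = i'.
  rewrite -(iter_findex (ri' i)) -iterD addnC iterD per_i.
  by rewrite iter_findex.
by rewrite -per_i -[RHS]per_i' !iterSr fii'.
Qed.

Lemma reaches_predecessor (C : finType) (f : C -> C) (k : C) :
  reaches f k -> exists i, [pred i | reaches f i && (f i == k)] =1 pred1 i.
Proof.
move=> rk; have /forallP rk' := rk.
(* The vertex before k on the cycle k -> f k -> ... -> k; it is k itself when
   k is a fixed point. *)
pose i := iter (findex f (f k) k) f k.
have fik : f i = k by rewrite -iterS iterSr iter_findex.
have ri : reaches f i by apply: reaches_trans rk (fconnect_iter _ _ _).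
exists i => l /=; apply/andP/eqP => [[rl /eqP fl]|->]; last by rewrite fik.
by apply: (reaches_predecessor_inj rl ri); rewrite fl fik.
Qed.

(** * Rooted trees as maps *)

Definition graph_off (C : finType) (f : C -> C) (j : C) : digraph C :=
  [set e | (e.1 != j) && (e.2 == f e.1)].

Lemma out_edges_graph_off (C : finType) (f : C -> C) (j i : C) :
  #|out_edges (graph_off f j) i| = (i != j).
Proof.
case: eqVneq => [->|ij].
  apply/eqP; rewrite cards_eq0; apply/eqP/setP=> e.
  by rewrite !inE; case: (e.1 == j); rewrite ?andbF.
apply/eqP/cards1P; exists (i, f i); apply/setP=> -[x y].
rewrite !inE xpair_eqE /=.
by case: (eqVneq x i) => [->|]; rewrite ?ij ?andbT ?andbF.
Qed.

Lemma cycle_graph_off (C : finType) (f : C -> C) (j : C) (c : seq C) :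
  cycle [rel i k | (i, k) \in graph_off f j] c = fcycle f c && (j \notin c).
Proof.
apply/idP/andP=> [cyc|[fc jc]].
  split.
    by apply: sub_cycle cyc => x y; rewrite /= inE => /andP[_ /= /eqP ->].
  by apply/negP=> /(next_cycle cyc); rewrite /= inE eqxx.
apply: (sub_in_cycle (P := [pred x | x != j])) fc.
  by move=> x y /= xj _ /eqP <-; rewrite !inE /= eqxx andbT.
by apply/allP=> x xc /=; apply: contraNneq jc => <-.
Qed.

(** A cycle of f that avoids j traps the orbits of its vertices away from j;
    conversely [reachesPn] finds such a cycle as soon as one orbit misses j. *)
Lemma graph_off_rooted (C : finType) (f : C -> C) (j : C) :
  (graph_off f j \in rooted_trees j) = reaches f j.
Proof.
rewrite inE out_edges_graph_off eqxx eqxx andbT.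
have -> : [forall (i | i != j), #|out_edges (graph_off f j) i| == 1%N].
  by apply/forall_inP=> i ij; rewrite out_edges_graph_off ij.
rewrite andbT; apply/asboolP/idP => [acy|/forallP rj c].
  apply/negPn/negP=> /reachesPn[c c0 fc].
  by have := acy c; rewrite /directed_loop c0 cycle_graph_off fc.
apply/negP; rewrite /directed_loop cycle_graph_off => /and3P[c0 fc /negP[]].
by case: c c0 fc => // x c _ fc; rewrite -(fconnect_cycle fc (mem_head _ _)).
Qed.

(** The value k at the root, where a tree has no outgoing edge, is a free
    parameter.  The default of [odflt] is never reached on a tree rooted
    at j. *)
Definition tree_map (C : finType) (j k : C) (g : digraph C) : {ffun C -> C} :=
  [ffun x => if x == j then k else odflt j [pick y | (x, y) \in g]].

Lemma graph_off_tree_map (C : finType) (j k : C) (g : digraph C) :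
  g \in rooted_trees j -> graph_off (tree_map j k g) j = g.
Proof.
rewrite inE => /and3P[_ /forall_inP out1 out0]; apply/setP=> -[x y].
rewrite !inE ffunE /=; case: (eqVneq x j) => [->|xj] /=.
  apply/esym/negP=> jy; move: out0; rewrite cards_eq0 => /eqP/setP/(_ (j, y)).
  by rewrite !inE jy eqxx.
have /cards1P[[x' y'] out_x] := out1 x xj.
have memP z : ((x, z) \in g) = ((x, z) == (x', y')).
  by move/setP/(_ (x, z)): out_x; rewrite !inE eqxx andbT.
have /andP[_ /eqP/= xx'] : ((x', y') \in g) && (x' == x).
  by move/setP/(_ (x', y')): out_x; rewrite !inE eqxx.
case: pickP => [z|/(_ y')]; rewrite memP xx' xpair_eqE eqxx /= ?eqxx //.
by move=> /eqP->; rewrite memP xx' xpair_eqE eqxx.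
Qed.

Lemma tree_map_graph_off (C : finType) (j k : C) (f : {ffun C -> C}) :
  (tree_map j k (graph_off f j) == f) = (f j == k).
Proof.
apply/eqP/eqP=> [<-|fj]; first by rewrite ffunE eqxx.
apply/ffunP=> x; rewrite ffunE; case: (eqVneq x j) => [->|xj] //.
case: pickP => [z|/(_ (f x))]; rewrite inE /= xj ?eqxx //.
by move=> /eqP.
Qed.

(** * Weights *)

Lemma prod_graph_off (R : comPzRingType) (C : finType) (M : C -> C -> R)
    (f : C -> C) (j : C) :
  \prod_(e in graph_off f j) M e.1 e.2 = \prod_(i | i != j) M i (f i).
Proof.
rewrite (reindex_onto (fun i => (i, f i)) fst) /=.
  by apply: eq_bigl => i; rewrite inE /= !eqxx !andbT.
by move=> [x y]; rewrite inE /= => /andP[_ /eqP ->].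
Qed.

(** Adding the edge from the root j to k to a tree rooted at j makes it the
    graph of a map. *)
Lemma tree_sum_mulr (R : comPzRingType) (C : finType) (M : C -> C -> R)
    (j k : C) :
  (\sum_(g in rooted_trees j) \prod_(e in g) M e.1 e.2) * M j k =
  \sum_(f : {ffun C -> C} | reaches f j && (f j == k)) \prod_i M i (f i).
Proof.
rewrite (reindex_onto (fun f : {ffun C -> C} => graph_off f j) (tree_map j k));
  last by move=> g; apply: graph_off_tree_map.
rewrite mulr_suml; apply: eq_big => [f|f].
  by rewrite graph_off_rooted tree_map_graph_off.
rewrite tree_map_graph_off => /andP[_ /eqP <-].
by rewrite prod_graph_off [RHS](bigD1 j) //= mulrC.
Qed.

Lemma sum_out_edges (R : comPzRingType) (C : finType) (M : C -> C -> R)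
    (k : C) :
  \sum_i (\sum_(g in rooted_trees k) \prod_(e in g) M e.1 e.2) * M k i =
  \sum_(f : {ffun C -> C} | reaches f k) \prod_i M i (f i).
Proof.
rewrite [RHS](partition_big (fun f : {ffun C -> C} => f k) predT) //=.
by apply: eq_bigr => i _; rewrite tree_sum_mulr.
Qed.

(** Each map is counted once for every edge into k that lies on its cycle, and
    there is exactly one such edge. *)
Lemma sum_in_edges (R : comPzRingType) (C : finType) (M : C -> C -> R)
    (k : C) :
  \sum_i (\sum_(g in rooted_trees i) \prod_(e in g) M e.1 e.2) * M i k =
  \sum_(f : {ffun C -> C} | reaches f k) \prod_i M i (f i).
Proof.
under eq_bigr do rewrite tree_sum_mulr.
rewrite (exchange_big_dep (fun f : {ffun C -> C} => reaches f k)) /=.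
  apply: eq_bigr => f /reaches_predecessor[i predE].
  by rewrite (eq_bigl _ _ predE) big_pred1_eq.
move=> i f _ /andP[ri /eqP <-]; exact: reaches_trans ri (fconnect1 f i).
Qed.

Theorem theorem4p2 (R : realType) (n : nat) (M : 'M[R]_n)
    (hM : stochastic M) :
  (tree_weight M)^T *m M = (tree_weight M)^T.
Proof.
case: hM => _ rows; apply/rowP=> k; rewrite !mxE.
under eq_bigr do rewrite !mxE.
rewrite sum_in_edges -sum_out_edges -mulr_sumr.
have -> : \sum_i M k i = 1.
  have /colP/(_ k) := rows; rewrite !mxE => <-.
  by apply: eq_bigr => i _; rewrite mxE mulr1.
by rewrite mulr1.
Qed.
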